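(* For any Eulerian poset $P=[\widehat{0},\widehat{1}]$ of rank $n+1$ ($n\ge 0$) we have $$ \operatorname{t}([\widehat{0},\widehat{1}),x)=\Phi_{P}^{\operatorname{rev}}(\mathcal{C},\mathcal{D})(1), $$ where $\mathcal{C},\mathcal{D}:\mathbb{Q}[x]\to\mathbb{Q}[x]$ are the linear operators given by $$ \mathcal{C}(x^m)=\begin{cases} x^{m+1}-x^{m-1} & \text{if } m\geq 2,\\ x^{m+1} & \text{if } m\in\{0,1\},\end{cases} \qquad \mathcal{D}(x^m)=\begin{cases} -1 & \text{if } m=2,\\ 1 & \text{if } m=0,\\ 0 & \text{otherwise,}\end{cases} $$ and $\Phi_{P}^{\operatorname{rev}}(\mathcal{C},\mathcal{D})$ is the linear operator obtained from the $cd$-index $\Phi_P(c,d)$ by first taking the reverse of each $cd$-monomial and then replacing each $c$ with $\mathcal{C}$ and each $d$ with $\mathcal{D}$ (products of letters becoming compositions of operators, the rightmost factor acting first).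
   Context: A graded poset is a finite poset with a unique minimum $\widehat{0}$, a unique maximum $\widehat{1}$ and a rank function $\rho:P\to\mathbb{N}$ with $\rho(\widehat{0})=0$ and $\rho(y)=\rho(x)+1$ whenever $y$ covers $x$; its rank is $\rho(\widehat{1})$. It is Eulerian if $\sum_{z\in[u,v]}(-1)^{\rho(z)}=0$ for all $u<v$. Write $[\widehat{0},p)=\{q: q<p\}$ and $[1,n]=\{1,\dots,n\}$. $cd$-index: for a graded poset $P$ of rank $n+1$ and $S\subseteq[1,n]$, let $f_S$ be the number of maximal chains of $P_S=\{u\in P:\rho(u)\in S\}$, and $h_S=\sum_{T\subseteq S}(-1)^{|S|-|T|}f_T$. The $ab$-index is $\sum_{S\subseteq[1,n]}h_Su_S$, where $u_S=u_1\cdots u_n$ is the word in noncommuting letters with $u_i=b$ if $i\in S$ and $u_i=a$ if $i\notin S$. If $P$ is Eulerian, the $ab$-index is (uniquely) a polynomial $\Phi_P(c,d)$ in the noncommuting variables $c=a+b$ and $d=ab+ba$, called the $cd$-index. Stanley's toric polynomials: $f(\emptyset,x)=g(\emptyset,x)=1$ ($\emptyset$ being $[\widehat{0},\widehat{1})$ for the Eulerian poset of rank $0$), and for an Eulerian poset of rank at least $1$, $$f([\widehat{0},\widehat{1}),x)=\sum_{p\in[\widehat{0},\widehat{1})} g([\widehat{0},p),x)(x-1)^{\rho(\widehat{1})-1-\rho(p)},$$ $$g([\widehat{0},\widehat{1}),x)=\sum_{i=0}^{\lfloor(\rho(\widehat{1})-1)/2\rfloor}\left([x^i]f([\widehat{0},\widehat{1}),x)-[x^{i-1}]f([\widehat{0},\widehat{1}),x)\right)x^i.$$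 By a theorem of Stanley, if the rank is $n+1$ then $f([\widehat{0},\widehat{1}),x)$ has degree $n$ and satisfies $x^nf([\widehat{0},\widehat{1}),1/x)=f([\widehat{0},\widehat{1}),x)$. Short toric polynomial: for an Eulerian poset of rank $n+1$, $\operatorname{t}([\widehat{0},\widehat{1}),x)$ is the unique polynomial $q(x)$ of degree $n$ with $q(x)=(-1)^nq(-x)$ and $f([\widehat{0},\widehat{1}),x)=x^{n/2}\left(q(\sqrt{x})+q(1/\sqrt{x})-q(0)\right)$; equivalently, it is obtained from $x^{n}f([\widehat{0},\widehat{1}),x^{-2})$ by discarding all terms of negative degree. *)

(* Defs.v *)
From HB Require Import structures.
From mathcomp Require Import all_boot all_order all_algebra.
From mathcomp Require Import finmap monalg.

Set Implicit Arguments.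
Unset Strict Implicit.
Unset Printing Implicit Defensive.

Import Order.TTheory GRing.Theory Num.Theory.
Local Open Scope ring_scope.

Section Poset.
Context {disp : Order.disp_t} {P : finTBPOrderType disp}.
Implicit Types (rho : P -> nat) (x y z u v p q : P).

Definition covers x y : bool :=
  (x < y)%O && ~~ [exists z, (x < z < y)%O].

Definition is_rank rho : Prop :=
  rho \bot%O = 0%N /\ (forall x y, covers x y -> rho y = (rho x).+1).

Definition eulerian rho : Prop :=
  forall u v, (u < v)%O ->
    \sum_(z | (u <= z <= v)%O) (-1) ^+ rho z = 0 :> int.

(* The subset S of {1, ..., n} is encoded by a set of ordinals i < n, the
   ordinal i standing for the rank i + 1. *)
Definition rank_selection rho n (S : {set 'I_n}) : {set P} :=
  [set u | [exists i in S, rho u == i.+1]].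

Definition chain_in (A : {set P}) : pred {set P} :=
  fun K => (K \subset A) && [forall x in K, forall y in K, (x >=< y)%O].

Definition flag_f rho n (S : {set 'I_n}) : nat :=
  #|[set K | maxset (chain_in (rank_selection rho S)) K]|.

Definition flag_h rho n (S : {set 'I_n}) : int :=
  \sum_(T : {set 'I_n} | T \subset S)
    (-1) ^+ (#|S| - #|T|) * (flag_f rho T)%:Z.

End Poset.

(* Polynomials in two noncommuting variables: the algebra of the free monoid
   of words over bool.  For ab-polynomials, false is a and true is b; for
   cd-polynomials, false is c and true is d. *)
Definition ncpoly := {malg rat[{fmonom bool}]}.

Definition word (w : seq bool) : ncpoly := << FMonom w >>.

Definition a_ : ncpoly := word [:: false].
Definition b_ : ncpoly := word [:: true].

(* w(a + b, ab + ba) for a cd-word w *)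
Definition cd_word_to_ab (w : seq bool) : ncpoly :=
  \prod_(l <- w) (if l then a_ * b_ + b_ * a_ else a_ + b_).

Definition cd_to_ab (Phi : ncpoly) : ncpoly :=
  \sum_(w <- msupp Phi) Phi@_w *: cd_word_to_ab w.

Section Indices.
Context {disp : Order.disp_t} {P : finTBPOrderType disp}.
Variables (rho : P -> nat) (n : nat).

Definition ab_index : ncpoly :=
  \sum_(S : {set 'I_n})
    (flag_h rho S)%:~R *: word [seq i \in S | i <- enum 'I_n].

Definition is_cd_index (Phi : ncpoly) : Prop := cd_to_ab Phi = ab_index.

End Indices.

Section Toric.
Context {disp : Order.disp_t} {P : finTBPOrderType disp}.
Variable rho : P -> nat.
Implicit Types (p q : P).

Definition g_of_f (r : nat) (f : {poly rat}) : {poly rat} :=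
  \poly_(i < ((r.-1)./2).+1) (f`_i - (if i is j.+1 then f`_j else 0)).

Definition f_of_g (g : P -> {poly rat}) p : {poly rat} :=
  if p == \bot%O then 1
  else \sum_(q | (q < p)%O) g q * ('X - 1) ^+ ((rho p).-1 - rho q).

(* k is a recursion bound; see toric_gE for the intended recursion. *)
Fixpoint toric_g_rec (k : nat) p : {poly rat} :=
  if k is k'.+1 then
    if p == \bot%O then 1
    else g_of_f (rho p) (f_of_g (toric_g_rec k') p)
  else 1.

(* toric_f p and toric_g p are f([0,p), x) and g([0,p), x). *)
Definition toric_g p : {poly rat} := toric_g_rec #|P| p.
Definition toric_f p : {poly rat} := f_of_g toric_g p.

Lemma toric_g_rec_stable k k' p :
  (#|[set q : P | (q < p)%O]| < k)%N -> (#|[set q : P | (q < p)%O]| < k')%N ->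
  toric_g_rec k p = toric_g_rec k' p.
Proof.
elim: k k' p => [|k IH] [|k'] p //= lt_k lt_k'.
case: eqP => // _; congr g_of_f; rewrite /f_of_g; case: ifP => // _.
apply: eq_bigr => q lt_qp; congr (_ * _).
have lt_card : (#|[set r : P | (r < q)%O]| < #|[set r : P | (r < p)%O]|)%N.
  apply: proper_card; apply/properP; split.
    by apply/subsetP => r; rewrite !inE => /lt_trans; apply.
  by exists q; rewrite !inE ?lt_qp ?ltxx.
by apply: IH; [apply: leq_trans lt_card _ | apply: leq_trans lt_card _].
Qed.

Lemma toric_gE p :
  toric_g p = if p == \bot%O then 1 else g_of_f (rho p) (toric_f p).
Proof.
have lt_card q : (#|[set r : P | (r < q)%O]| < #|P|)%N.
  rewrite -cardsT; apply: proper_card; apply/properP; split.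
    exact: subsetT.
  by exists q; rewrite !inE ?ltxx.
rewrite /toric_g (@toric_g_rec_stable _ #|P|.+1) //.
exact: leq_trans (lt_card p) (leqnSn _).
Qed.

Lemma toric_fE p :
  toric_f p = if p == \bot%O then 1
    else \sum_(q | (q < p)%O) toric_g q * ('X - 1) ^+ ((rho p).-1 - rho q).
Proof. by []. Qed.

(* The identity f(x) = x^(n/2) (q(sqrt x) + q(1/sqrt x) - q(0)) is written
   with y = sqrt x; an identity of Laurent polynomials over rat holds as soon
   as it holds at every nonzero y. *)
Definition is_short_toric (n : nat) (q : {poly rat}) : Prop :=
  [/\ size q = n.+1,
      q = (-1) ^+ n *: (q \Po (- 'X)) &
      forall y : rat, y != 0 ->
        (toric_f \top%O).[y ^+ 2] = y ^+ n * (q.[y] + q.[y^-1] - q.[0])].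

End Toric.

Definition linear_ext (u : nat -> {poly rat}) (p : {poly rat}) : {poly rat} :=
  \sum_(m < size p) p`_m *: u m.

Lemma linear_extXn u m : linear_ext u 'X^m = u m.
Proof.
rewrite /linear_ext size_polyXn big_ord_recr /= big1 ?add0r.
  by rewrite coefXn eqxx scale1r.
by move=> i _; rewrite coefXn (ltn_eqF (ltn_ord i)) scale0r.
Qed.

Lemma linear_ext_widen u (p : {poly rat}) k : (size p <= k)%N ->
  linear_ext u p = \sum_(m < k) p`_m *: u m.
Proof.
move=> le_pk; rewrite /linear_ext (big_ord_widen k (fun m => p`_m *: u m)) //.
rewrite big_mkcond; apply: eq_bigr => i _; case: ltnP => // le_pi.
by rewrite nth_default ?scale0r.
Qed.

Lemma linear_ext_is_linear u : linear (linear_ext u).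
Proof.
move=> a p q; pose k := maxn (size (a *: p + q)) (maxn (size p) (size q)).
rewrite !(@linear_ext_widen u _ k) /k ?leq_max ?leqnn ?orbT //.
rewrite scaler_sumr -big_split /=; apply: eq_bigr => i _.
by rewrite coefD coefZ scalerDl scalerA.
Qed.

HB.instance Definition _ u :=
  GRing.isLinear.Build rat {poly rat} {poly rat} _ (linear_ext u)
    (linear_ext_is_linear u).

Definition opC : {poly rat} -> {poly rat} :=
  linear_ext (fun m => if (2 <= m)%N then 'X^(m.+1) - 'X^(m.-1) else 'X^(m.+1)).

Definition opD : {poly rat} -> {poly rat} :=
  linear_ext (fun m => if m == 2%N then -1 else if m == 0%N then 1 else 0).

(* The leftmost letter of w is the outermost operator. *)
Definition word_op (w : seq bool) : {poly rat} -> {poly rat} :=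
  foldr (fun l F => (if l then opD else opC) \o F) id w.

(* Phi^rev(C, D) *)
Definition rev_op (Phi : ncpoly) (p : {poly rat}) : {poly rat} :=
  \sum_(w <- msupp Phi) Phi@_w *: word_op (rev w) p.

(* Main.v *)
From HB Require Import structures.
Require Import Defs.
From mathcomp Require Import all_boot all_order all_algebra.
From mathcomp Require Import finmap monalg.
From mathcomp Require Import zify ring.

Import Order.TTheory GRing.Theory Num.Theory.
Local Open Scope ring_scope.

Set Implicit Arguments.
Unset Strict Implicit.

(* Splitting a chain at its largest element turns the recursion for f into a
   sum over flags: the word of a flag, read from left to right, acts on 1 by
   multiplication by X - 1 at an unused rank and by passing from f to g at a
   used rank.  Passing from flag f- to flag h-numbers, the letter b of the
   ab-index acts as f |-> g and the letter a as f |-> (X - 1) f + g.  On a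
   palindromic f, the resulting action of c = a + b is f |-> (X - 1) f + 2 g,
   which flips the sign of the lower half of the antipalindromic polynomial
   (X - 1) f; read on the upper half of the coefficients, which is the short
   toric polynomial, this is the operator C, and likewise d = ab + ba acts as
   the operator D.  The letters act from left to right, hence the reversal. *)

(** * The letters [c] and [d] as the operators C and D on symmetrized polynomials *)

Section Symmetrization.
Implicit Types (m i j : nat) (p q : {poly rat}).

(* For [q] of the parity of [m] and degree at most [m], this is
   x^(m/2) (q(sqrt x) + q(1/sqrt x) - q(0)); see [horner_symp]. *)
Definition symp m q : {poly rat} :=
  \poly_(i < m.+1) q`_((m - i.*2) + (i.*2 - m)).

Lemma symp_is_linear m : linear (symp m).
Proof.
move=> a p q; apply/polyP => i; rewrite coefD coefZ !coef_poly.
by case: ifP; rewrite ?mulr0 ?addr0 // coefD coefZ.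
Qed.
HB.instance Definition _ m :=
  GRing.isLinear.Build rat {poly rat} {poly rat} _ (symp m) (symp_is_linear m).

Definition parity_poly m q := forall i, odd (m + i) -> q`_i = 0.

(** Nothing is lost under [symp m]: for [i <= m] of the parity of [m], the coefficient of [q] at [i]
    reappears at index (m + i)/2. *)
Lemma symp_inj m q : (size q <= m.+1)%N -> parity_poly m q ->
  symp m q = 0 -> q = 0.
Proof.
move=> sz_q par_q sym0; apply/polyP => i; rewrite coef0.
case: (boolP (odd (m + i))) => [/par_q //|ev_mi].
case: (leqP i m) => [le_im|lt_mi]; last by rewrite nth_default ?(leq_trans sz_q).
have /(congr1 (fun r : {poly rat} => r`_((m + i)./2))) := sym0.
have eq2 : ((m + i)./2.*2 = m + i)%N by rewrite even_halfK.
rewrite coef0 coef_poly ifT; last by lia.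
by have -> : (m - (m + i)./2.*2 + ((m + i)./2.*2 - m))%N = i by lia.
Qed.

Lemma coef_sum_delta q k i : (i < k)%N ->
  \sum_(m < k) q`_m * (val m == i)%:R = q`_i.
Proof.
move=> lt_ik; rewrite (bigD1 (Ordinal lt_ik)) //= eqxx mulr1 big1 ?addr0 //.
by move=> m; rewrite -val_eqE /= => /negPf->; rewrite mulr0.
Qed.

(** C is multiplication by x - 1/x with all terms of exponent at most 0 dropped; this is what the
    case split on [m] in its definition encodes. *)
Lemma coef_opC q i :
  (opC q)`_i = if i is j.+1 then q`_j - q`_j.+2 else 0.
Proof.
(* The bound [i.+2] keeps both contributing exponents, [i.-1] and [i.+1], in the range of the sum
   even when [q] is short. *)
rewrite /opC (@linear_ext_widen _ _ (maxn (size q) i.+2)) ?leq_maxl //.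
have : (i.+1 < maxn (size q) i.+2)%N by rewrite leq_maxr.
move: (maxn _ _) => k; rewrite coef_sum.
case: i => [|i] lt_ik.
  apply: big1 => [[m ltm]] _ /=; rewrite coefZ.
  by case: m {ltm} => [|[|m]]; rewrite ?coefB !coefXn ?subrr mulr0.
rewrite -[q`_i](@coef_sum_delta _ k) -1?[q`_i.+2](@coef_sum_delta _ k); try lia.
rewrite -sumrB; apply: eq_bigr => [[m ltm]] _ /=; rewrite coefZ -mulrBr.
congr (_ * _); case: m {ltm} => [|[|m]]; rewrite ?coefB !coefXn /= ?subr0.
- by rewrite eqSS eq_sym.
- by rewrite eqSS eq_sym.
by rewrite !eqSS eq_sym; congr (_ - (nat_of_bool _)%:R); apply: eq_sym.
Qed.

Lemma opDE q : opD q = (q`_0 - q`_2)%:P.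
Proof.
rewrite /opD (@linear_ext_widen _ _ (maxn (size q) 3)) ?leq_maxl //.
have lt3 : (2 < maxn (size q) 3)%N by rewrite leq_maxr.
have lt0 : (0 < maxn (size q) 3)%N by lia.
rewrite (bigD1 (Ordinal lt0)) //= (bigD1 (Ordinal lt3)) //=.
rewrite big1 => [|[m ltm]]; last first.
  rewrite -!val_eqE /= => /andP[ne1 ne2].
  by rewrite (negPf ne1) (negPf ne2) scaler0.
by rewrite addr0 scalerN !alg_polyC polyCB.
Qed.

Lemma size_opC m q : (size q <= m.+1)%N -> (size (opC q) <= m.+2)%N.
Proof.
move=> sz_q; apply/leq_sizeP => [[//|j] lej].
by rewrite coef_opC !nth_default ?subrr // (leq_trans sz_q) //; lia.
Qed.

Lemma size_opD m q : (size (opD q) <= m.+1)%N.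
Proof. by rewrite opDE (leq_trans (size_polyC_leq1 _)). Qed.

Lemma parity_opC m q : parity_poly m q -> parity_poly m.+1 (opC q).
Proof.
by move=> par [|i] odd_i; rewrite coef_opC // !par ?subr0 //; lia.
Qed.

Lemma parity_opD m q : parity_poly m q -> parity_poly m.+2 (opD q).
Proof.
move=> par i odd_i; rewrite opDE coefC; case: eqP => // i0.
by rewrite !par ?subr0 //; lia.
Qed.

Lemma g_of_f_is_linear r : linear (g_of_f r).
Proof.
move=> a p q; apply/polyP => i; rewrite coefD coefZ !coef_poly.
case: ifP => _; rewrite ?mulr0 ?addr0 // !coefD !coefZ.
by case: i => [|i]; rewrite ?coefD ?coefZ; ring.
Qed.
HB.instance Definition _ r :=
  GRing.isLinear.Build rat {poly rat} {poly rat} _ (g_of_f r)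
    (g_of_f_is_linear r).

Lemma coef_g_of_f r p i : (g_of_f r p)`_i =
  if (i <= r.-1./2)%N then p`_i - (if i is j.+1 then p`_j else 0) else 0.
Proof. by rewrite coef_poly. Qed.

Lemma coef_mulX1 p i :
  (('X - 1) * p)`_i = (if i is j.+1 then p`_j else 0) - p`_i.
Proof. by rewrite mulrBl mul1r coefB coefXM; case: i. Qed.

(** The index is |m - 2i|, one of the two truncated differences being 0. For [i > m] it exceeds [m],
    so cutting [symp] off at degree [m] is harmless. *)
Lemma coef_symp m q i : (size q <= m.+1)%N ->
  (symp m q)`_i = q`_((m - i.*2) + (i.*2 - m)).
Proof.
move=> sz_q; rewrite coef_poly; case: ifP => // lt_i.
by rewrite nth_default // (leq_trans sz_q) //; lia.
Qed.

(* The coefficients of [(X - 1) f] are antisymmetric when those of [f] are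
   symmetric; the operator flips the sign of the lower half of them. *)
Lemma symp_opC m q : (size q <= m.+1)%N ->
  ('X - 1) * symp m q + g_of_f m.+1 (symp m q) *+ 2 = symp m.+1 (opC q).
Proof.
move=> sz_q; apply/polyP => i.
rewrite coefD coefMn coef_mulX1 coef_g_of_f /= (coef_symp _ (size_opC sz_q)).
rewrite !coef_symp // coef_opC.
have -> : (if i is j.+1 then (symp m q)`_j else 0) =
  if i is j.+1 then q`_((m - j.*2) + (j.*2 - m)) else 0.
  by case: i => // j; rewrite coef_symp.
case: ifP => hi.
  case: i hi => [|j] hi.
    rewrite double0 !subn0 /= !addn0 [q`_m.+2]nth_default; last first.
      by rewrite (leq_trans sz_q).
    by ring.
  have -> : (m.+1 - j.+1.*2 + (j.+1.*2 - m.+1))%N = (m - j.+1.*2 + (j.+1.*2 - m)).+1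
    by lia.
  have -> : (m - j.*2 + (j.*2 - m))%N = (m - j.+1.*2 + (j.+1.*2 - m)).+2 by lia.
  by ring.
case: i hi => [//|j] hi; rewrite addr0.
(* At the centre of an odd [m] the two neighbouring coefficients are both the coefficient of [q] at
   1 and cancel, in accordance with the zero constant term of [opC q]. *)
case: (eqVneq (j.+1.*2) m.+1) => e.
  have -> : (m.+1 - j.+1.*2 + (j.+1.*2 - m.+1))%N = 0%N by lia.
  rewrite (_ : _ + (j.*2 - _) = m - j.+1.*2 + (j.+1.*2 - m))%N ?subrr //; lia.
have -> : (m.+1 - j.+1.*2 + (j.+1.*2 - m.+1))%N = (m - j.*2 + (j.*2 - m)).+1
  by lia.
by have -> : (m - j.+1.*2 + (j.+1.*2 - m))%N = (m - j.*2 + (j.*2 - m)).+2 by lia.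
Qed.

Lemma coef_g_of_f_symp m q i : (size q <= m.+1)%N ->
  (g_of_f m.+1 (symp m q))`_i =
  if (i <= m./2)%N then q`_(m - i.*2) - q`_(m - i.*2).+2 else 0.
Proof.
move=> sz_q; rewrite coef_g_of_f /= coef_symp //; case: ifP => // hi.
have -> : (m - i.*2 + (i.*2 - m))%N = (m - i.*2)%N by lia.
(* At [i = 0] there is no preceding coefficient to subtract; the coefficient of [q] at [m.+2] stands
   in for it and vanishes by the size bound. *)
case: i hi => [|j] hi; first by rewrite [q`_ _.+2]nth_default // (leq_trans sz_q) //; lia.
by rewrite coef_symp //; congr (_ - _`_ _); lia.
Qed.

(** Substituting a = c - b in ab + ba cancels the two bb terms and leaves g of [symp m.+1 (opC q)]
    plus (X - 1) B, where B = g(f). The lower half of [symp m.+1 (opC q)] is B itself, so the two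
    summands cancel there; all that survives is the last coefficient of B, shifted to the centre,
    when [m] is even. *)
Lemma symp_opD m q : (size q <= m.+1)%N ->
  g_of_f m.+2 (('X - 1) * symp m q + g_of_f m.+1 (symp m q)) +
    (('X - 1) * g_of_f m.+1 (symp m q) + g_of_f m.+2 (g_of_f m.+1 (symp m q)))
  = symp m.+2 (opD q).
Proof.
move=> sz_q; set B := g_of_f m.+1 _.
have -> : ('X - 1) * symp m q + B = symp m.+1 (opC q) - B.
  by rewrite -symp_opC // -/B; ring.
rewrite raddfB /= [X in _ + X]addrC addrA addrNK; apply/polyP => i.
rewrite coefD coef_mulX1 coef_g_of_f (coef_symp _ (size_opC sz_q)).
rewrite coef_symp; last exact: size_opD.
rewrite opDE coefC.
have -> : (if i is j.+1 then (symp m.+1 (opC q))`_j else 0) =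
  if i is j.+1 then (opC q)`_((m.+1 - j.*2) + (j.*2 - m.+1)) else 0.
  by case: i => // j; rewrite coef_symp ?size_opC.
have low j : (j <= m./2)%N ->
    (opC q)`_((m.+1 - j.*2) + (j.*2 - m.+1)) = B`_j.
  move=> le_j; rewrite coef_g_of_f_symp // le_j coef_opC.
  by have -> : (m.+1 - j.*2 + (j.*2 - m.+1))%N = (m - j.*2).+1 by lia.
case: (leqP i m./2) => hi.
  rewrite ifT; last by rewrite /=; lia.
  rewrite low // ifF; last by lia.
  by case: i hi => [|j] hi; rewrite ?low; try lia; ring.
have -> : B`_i = 0 by rewrite coef_g_of_f_symp // leqNgt hi.
case: i hi => [|j] hi; first lia.
case: ifP => [/= hj|/= hj].
  (* Here [m] is odd and the index is the centre of [symp m.+1], where the zero constant term of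
     [opC q] is read. *)
  have odd_m : (m.+1 - j.+1.*2 + (j.+1.*2 - m.+1))%N = 0%N by lia.
  by rewrite odd_m coef_opC /= low ?ifF; try lia; ring.
rewrite subr0 add0r coef_g_of_f_symp //.
(* In the remaining case [m] is even and [j] is m/2: the surviving coefficient. *)
case: ifP => hj'; last by rewrite ifF //; lia.
have -> : (m - j.*2 = 0)%N by lia.
by rewrite ifT //; lia.
Qed.

End Symmetrization.

(** * Evaluation at squares and the definition of the short toric polynomial *)

Section SympEval.
Implicit Types (m i j : nat) (p q : {poly rat}).
(** With m = j + 2k, the equation |m - 2i| = j has the solutions k and j + k. They coincide for
    [j = 0], which is why q(0) is subtracted once in the functional identity. *)
Lemma sympXn j k :
  symp (j + k.*2) 'X^j = (if j == 0%N then 0 else 'X^k) + 'X^(j + k).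
Proof.
apply/polyP => i; rewrite coef_symp ?size_polyXn; last by lia.
rewrite coefD (fun_if (fun r : {poly rat} => r`_i)) coef0 !coefXn.
case: (eqVneq i k) => ik; case: (eqVneq i (j + k)%N) => ijk; case: (eqVneq j 0%N) => j0;
  by case: eqP => //; lia.
Qed.

Lemma horner_symp m q y : (size q <= m.+1)%N -> parity_poly m q -> y != 0 ->
  (symp m q).[y ^+ 2] = y ^+ m * (q.[y] + q.[y^-1] - q.[0]).
Proof.
move=> sz_q par_q y0.
have -> : q = \sum_(j < m.+1) q`_j *: 'X^j.
  apply/polyP => i; rewrite -poly_def coef_poly; case: ltnP => // hi.
  by rewrite nth_default // (leq_trans sz_q).
rewrite linear_sum /= !horner_sum -big_split /= -sumrB mulr_sumr.
apply: eq_bigr => [[j le_j]] _ /=; rewrite linearZ /= !hornerZ !hornerXn.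
case: (boolP (odd (m + j))) => [/par_q->|ev_mj]; first by rewrite !mul0r; ring.
have [k ->] : exists k, m = (j + k.*2)%N.
  by exists (m - j)./2; rewrite even_halfK; lia.
rewrite -mulrDr -mulrBr mulrCA; congr (_ * _).
rewrite sympXn hornerD hornerXn expr0n.
have yj : y ^+ j * y^-1 ^+ j = 1 by rewrite -exprMn divff ?expr1n.
have -> : (y ^+ 2) ^+ (j + k) = y ^+ (j + k.*2) * y ^+ j.
  by rewrite -exprM -exprD; congr (_ ^+ _); lia.
have -> : (if j == 0%N then 0 else 'X^k : {poly rat}).[y ^+ 2] =
    if j == 0%N then 0 else y ^+ (j + k.*2) * y^-1 ^+ j.
  case: eqP => _; rewrite ?horner0 // hornerXn exprD mulrAC yj mul1r -exprM.
  by congr (_ ^+ _); lia.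
by case: eqP => [->|_] /=; rewrite ?expr0; ring.
Qed.

Lemma poly_eq_on_squares (p q : {poly rat}) :
  (forall y : rat, y != 0 -> p.[y ^+ 2] = q.[y ^+ 2]) -> p = q.
Proof.
move=> eq_pq; apply/eqP; rewrite -subr_eq0; apply/negPn/negP => nz.
(* The squares of 1, 2, 3, ... are distinct, and there are as many here as the size of the
   difference, one more than its degree allows as roots. *)
pose rs : seq rat := [seq (i.+1%:R : rat) ^+ 2 | i <- iota 0 (size (p - q))].
suff : (size rs < size (p - q)%R)%N by rewrite size_map size_iota ltnn.
apply: max_poly_roots => //.
  apply/allP => _ /mapP[i _ ->]; rewrite rootE hornerD hornerN eq_pq ?subrr //.
  by rewrite pnatr_eq0.
rewrite map_inj_uniq ?iota_uniq // => i j /eqP.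
by rewrite -!natrX eqr_nat eqn_exp2r // => /eqP[].
Qed.

(** This trades the functional identity for one between coefficients, linear in [t]; the symmetry
    under x -> -x becomes a parity condition because 2 is invertible. *)
Lemma is_short_toricE (disp : Order.disp_t) (P : finTBPOrderType disp)
    (rho : P -> nat) n t :
  is_short_toric rho n t <->
  [/\ size t = n.+1, parity_poly n t & symp n t = toric_f rho \top%O].
Proof.
have parE : t = (-1) ^+ n *: (t \Po (- 'X)) <-> parity_poly n t.
  have coefN i : ((-1) ^+ n *: (t \Po (- 'X)))`_i = (-1) ^+ (n + i) * t`_i.
    have -> : t \Po (- 'X) = \poly_(j < size t) ((-1) ^+ j * t`_j).
      rewrite comp_polyE poly_def; apply: eq_bigr => j _.
      by rewrite -scaleN1r exprZn scalerA mulrC.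
    rewrite coefZ exprD -mulrA coef_poly; congr (_ * _).
    by case: ltnP => // hi; rewrite nth_default ?mulr0.
  split=> [/polyP eq_t i odd_i|par].
    have := eq_t i; rewrite coefN -signr_odd odd_i mulN1r => /eqP.
    by rewrite -addr_eq0 -mulr2n mulrn_eq0 /= => /eqP.
  apply/polyP => i; rewrite coefN -signr_odd; case: (boolP (odd _)) => [/par->|_].
    by rewrite mulr0.
  by rewrite mul1r.
split=> [[sz /parE par eval_t]|[sz par eq_t]]; split=> //.
- apply: poly_eq_on_squares => y y0.
  by rewrite horner_symp ?sz // eval_t.
- exact/parE.
by move=> y y0; rewrite -eq_t horner_symp ?sz.
Qed.
End SympEval.

(** * Words acting letter by letter; passage between flag f- and h-numbers *)

Section WordOperators.
Implicit Types (m n : nat) (l : bool) (f : {poly rat}) (w : seq bool).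

(** [m] counts the letters already read, so the current letter belongs to rank [m.+1], the rank at
    which g is formed. *)
Definition flag_step l m f : {poly rat} :=
  if l then g_of_f m.+1 f else ('X - 1) * f.

Definition ab_step l m f : {poly rat} :=
  if l then g_of_f m.+1 f else ('X - 1) * f + g_of_f m.+1 f.

Fixpoint run (step : bool -> nat -> {poly rat} -> {poly rat}) m w f :=
  if w is l :: w' then run step m.+1 w' (step l m f) else f.

Lemma run_cat step m w1 w2 f :
  run step m (w1 ++ w2) f = run step (m + size w1) w2 (run step m w1 f).
Proof.
by elim: w1 m f => [|l w1 IH] m f; rewrite ?addn0 //= IH addSnnS.
Qed.

Lemma flag_step_is_linear l m : linear (flag_step l m).
Proof.
by move=> a p q; case: l; rewrite /flag_step ?linearP //= mulrDr -scalerAr.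
Qed.
HB.instance Definition _ l m :=
  GRing.isLinear.Build rat {poly rat} {poly rat} _ (flag_step l m)
    (flag_step_is_linear l m).

Lemma ab_step_is_linear l m : linear (ab_step l m).
Proof.
move=> a p q; case: l; rewrite /ab_step ?linearP //= mulrDr -scalerAr.
by rewrite scalerDr addrACA.
Qed.
HB.instance Definition _ l m :=
  GRing.isLinear.Build rat {poly rat} {poly rat} _ (ab_step l m)
    (ab_step_is_linear l m).

Lemma run_flag_step_is_linear m w : linear (run flag_step m w).
Proof.
by move=> a p q; elim: w m p q => //= l w IH m p q; rewrite linearP IH.
Qed.
HB.instance Definition _ m w :=
  GRing.isLinear.Build rat {poly rat} {poly rat} _ (run flag_step m w)
    (run_flag_step_is_linear m w).

Lemma all2_implb_map (I : Type) (e : seq I) (A B : pred I) :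
  all2 implb (map A e) (map B e) = all (fun i => A i ==> B i) e.
Proof. by elim: e => //= i e ->. Qed.

(* [ab_step l] is the sum of [flag_step l'] over [l <= l']: the substitution
   turning the flag h-vector into the flag f-vector. *)
Lemma run_ab_step n (w : n.-tuple bool) m f :
  run ab_step m w f =
  \sum_(v : n.-tuple bool | all2 implb w v) run flag_step m v f.
Proof.
elim: n w m f => [|n IH] w m f.
  rewrite (big_pred1 [tuple]) => [|v]; first by rewrite tuple0.
  by rewrite (tuple0 w) (tuple0 v) /= eqxx.
have [l [w' ->]] : exists l (w' : n.-tuple bool), w = [tuple of l :: w'].
  by case/tupleP: w => l w'; exists l, w'.
rewrite (reindex (fun p : bool * n.-tuple bool => [tuple of p.1 :: p.2])) /=; last first.
  exists (fun v => (thead v, [tuple of behead v])) => [[b v] _|v _] /=.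
    by rewrite theadE; congr pair; apply: val_inj.
  by rewrite [in RHS](tuple_eta v).
rewrite -(pair_big_dep (fun b => implb l b) (fun _ (v : n.-tuple bool) => all2 implb w' v)
  (fun b (v : n.-tuple bool) => run flag_step m.+1 v (flag_step b m f))) /=.
rewrite big_mkcond big_bool /= IH.
case: l => /=; first by rewrite addr0.
by rewrite -big_split /=; apply: eq_bigr => v _; rewrite addrC -linearD.
Qed.

Definition set_word n (S : {set 'I_n}) : seq bool := [seq i \in S | i <- enum 'I_n].

Lemma run_ab_step_set n (T : {set 'I_n}) m f :
  run ab_step m (set_word T) f =
  \sum_(S : {set 'I_n} | T \subset S) run flag_step m (set_word S) f.
Proof.
have word_tuple (S : {set 'I_n}) :
    set_word S = [tuple i \in S | i < n] by [].
rewrite word_tuple run_ab_step.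
rewrite (reindex (fun S : {set 'I_n} => [tuple i \in S | i < n])) /=; last first.
  exists (fun v : n.-tuple bool => [set i | tnth v i]) => [S _|v _].
    by apply/setP => i; rewrite inE tnth_mktuple.
  by apply: eq_from_tnth => i; rewrite tnth_mktuple inE.
apply: eq_bigl => S; rewrite all2_implb_map.
apply/allP/subsetP => sTS i; first by move=> /(implyP (sTS i _)); apply; rewrite mem_enum.
by move=> _; apply/implyP/sTS.
Qed.

(** If [R] is not [S], toggling a fixed element of [S] outside [R] pairs the sets in between with
    opposite signs. *)
Lemma sum_sign_interval (I : finType) (R S : {set I}) : R \subset S ->
  \sum_(T : {set I} | (R \subset T) && (T \subset S)) (-1) ^+ (#|T| - #|R|)
  = (R == S)%:R :> int.
Proof.
move=> sRS; case: (eqVneq R S) => [->|neRS].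
  rewrite (big_pred1 S) ?subnn // => T.
  by rewrite /= eqEsubset andbC.
have [x xS xR] : exists2 x, x \in S & x \notin R.
  by apply/subsetPn; apply: contra neRS => sSR; rewrite eqEsubset sRS.
pose flip (T : {set I}) := if x \in T then T :\ x else x |: T.
have flipK : involutive flip.
  move=> T; rewrite /flip; case: (boolP (x \in T)) => xT.
    by rewrite setD11 setD1K.
  by rewrite setU11 setU1K.
set s := \sum_(T | _) _; suff : s = - s.
  by move=> /eqP; rewrite -addr_eq0 -mulr2n mulrn_eq0 /= => /eqP.
rewrite {1}/s (reindex_inj (inv_inj flipK)) -sumrN /=; apply: eq_big => T.
  rewrite /flip; case: (boolP (x \in T)) => xT.
    rewrite subsetD1 xR andbT; congr (_ && _).
    by rewrite -{2}(setD1K xT) subUset sub1set xS.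
  rewrite subUset sub1set xS /=; congr (_ && _).
  by rewrite -{2}(setU1K xT) subsetD1 xR andbT.
rewrite /flip; case: (boolP (x \in T)) => xT /andP[sR _].
  rewrite [in RHS](cardsD1 x T) xT add1n subSn ?exprS ?mulN1r ?opprK //.
  exact: subset_leq_card.
have sRT : R \subset T.
  by rewrite -(setU1K xT) subsetD1 xR sR.
by rewrite cardsU1 xT add1n subSn ?exprS ?mulN1r // subset_leq_card.
Qed.

Lemma sum_flag_h (disp : Order.disp_t) (P : finTBPOrderType disp)
    (rho : P -> nat) n (S : {set 'I_n}) :
  \sum_(T : {set 'I_n} | T \subset S) flag_h rho T = (flag_f rho S)%:Z.
Proof.
rewrite /flag_h (exchange_big_dep (fun R : {set 'I_n} => R \subset S)) /=; last first.
  by move=> T R sTS sRT; apply: subset_trans sTS.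
rewrite (eq_bigr (fun R => (R == S)%:R * (flag_f rho R)%:Z)) => [|R sRS].
  rewrite (bigD1 S) //= eqxx mul1r big1 ?addr0 // => R /andP[_ /negPf->].
  by rewrite mul0r.
rewrite -(sum_sign_interval sRS) mulr_suml; apply: eq_bigl => T.
by rewrite andbC.
Qed.

(** Only words of length [N] count: this isolates one homogeneous component, so that [Phi] can be
    treated degree by degree. *)
Definition ab_eval N (u : ncpoly) : {poly rat} :=
  mmap (@polyC rat) (fun w : {fmonom bool} =>
    if size w == N then run ab_step 0 w 1 else 0) u.

Lemma ab_eval_is_linear N : linear (ab_eval N).
Proof.
move=> c u v; rewrite {1}/ab_eval mmapD -/(ab_eval N _) -/(ab_eval N v); congr (_ + _).
rewrite /ab_eval (mmapEw (msuppZ_le _ _)) mmapE scaler_sumr /=.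
by apply/eq_bigr=> k _; rewrite linearZ /= -!mul_polyC rmorphM /= mulrA.
Qed.
HB.instance Definition _ N :=
  GRing.isLinear.Build rat ncpoly {poly rat} _ (ab_eval N) (@ab_eval_is_linear N).

Lemma ab_eval_word N w : ab_eval N (word w) =
  if size w == N then run ab_step 0 w 1 else 0.
Proof. by rewrite /ab_eval /word mmapU mul1r. Qed.

Lemma wordM w1 w2 : word w1 * word w2 = word (w1 ++ w2).
Proof. by rewrite /word malgM_def fgmulUU mulr1; congr (<< _ *g _ >>); apply: fmmulE. Qed.

(** Words act from left to right, so a right factor acts last, at position [m]. No word of length 0
    ends in a letter, whence the value 0. *)
Lemma ab_evalM_letter N u l :
  ab_eval N (u * word [:: l]) =
  if N is m.+1 then ab_step l m (ab_eval m u) else 0.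
Proof.
have -> : u = \sum_(k <- msupp u) u@_k *: word k.
  rewrite {1}[u]monalgE; apply: eq_bigr => k _.
  apply/malgP => k'; rewrite mcoeffZ !mcoeffU mulr_natr.
  by rewrite fmK.
rewrite mulr_suml linear_sum /=; case: N => [|m].
  apply: big1 => k _; rewrite -scalerAl wordM linearZ /= ab_eval_word size_cat addn1.
  by rewrite scaler0.
rewrite [ab_eval m _]linear_sum [RHS]linear_sum /=; apply: eq_bigr => k _.
rewrite -scalerAl wordM !linearZ /= !ab_eval_word size_cat addn1 eqSS; congr (_ *: _).
case: eqP => [<-|_]; last by rewrite linear0.
by rewrite run_cat.
Qed.
End WordOperators.

(** * Evaluation of cd-polynomials and of the ab-index *)

Section CdIndex.
Implicit Types (m n N : nat) (w : seq bool).

Lemma word_nil : word [::] = 1.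
Proof. by rewrite /word -[FMonom _]fmoneE. Qed.

Definition cd_deg w : nat := \sum_(l <- w) (if l then 2 else 1).

Definition cd_value w : {poly rat} := word_op (rev w) 1.

Lemma cd_deg_rcons w l : cd_deg (rcons w l) = (cd_deg w + if l then 2 else 1)%N.
Proof. by rewrite /cd_deg -cats1 big_cat big_seq1. Qed.

Lemma cd_value_rcons w l :
  cd_value (rcons w l) = if l then opD (cd_value w) else opC (cd_value w).
Proof. by rewrite /cd_value rev_rcons /=; case: l. Qed.

Lemma cd_value_homog w :
  (size (cd_value w) <= (cd_deg w).+1)%N /\ parity_poly (cd_deg w) (cd_value w).
Proof.
elim/last_ind: w => [|w l [sz par]].
  rewrite /cd_value /cd_deg big_nil size_poly1; split=> // -[|i] //= _.
  by rewrite coef1.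
rewrite cd_value_rcons cd_deg_rcons; case: l; rewrite ?addn2 ?addn1.
  by split; [apply: size_opD | apply: parity_opD].
by split; [apply: size_opC | apply: parity_opC].
Qed.

Lemma ab_evalD N u v : ab_eval N (u + v) = ab_eval N u + ab_eval N v.
Proof. exact: (raddfD (ab_eval N)). Qed.

Lemma ab_evalM_a N u :
  ab_eval N (u * a_) = if N is m.+1 then ab_step false m (ab_eval m u) else 0.
Proof. exact: ab_evalM_letter. Qed.

Lemma ab_evalM_b N u :
  ab_eval N (u * b_) = if N is m.+1 then ab_step true m (ab_eval m u) else 0.
Proof. exact: ab_evalM_letter. Qed.

Lemma ab_evalM_c N u : ab_eval N (u * (a_ + b_)) =
  if N is m.+1 then ('X - 1) * ab_eval m u + g_of_f m.+1 (ab_eval m u) *+ 2 else 0.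
Proof.
rewrite (mulrDr u a_ b_).
(* A rewrite would unify [a_] with [b_] by unfolding the monoid algebra,
   which does not terminate in practice; hence the explicit terms. *)
apply: etrans (ab_evalD _ _ _) _.
apply: etrans (congr2 +%R (ab_evalM_a N u) (ab_evalM_b N u)) _.
by case: N => [|m]; rewrite ?addr0 // mulr2n addrA.
Qed.

Lemma ab_evalM_ab N u : ab_eval N (u * (a_ * b_)) =
  if N is m.+2 then ab_step true m.+1 (ab_step false m (ab_eval m u)) else 0.
Proof.
rewrite (mulrA u a_ b_) ab_evalM_b; case: N => [|[|m]] //; rewrite ab_evalM_a //.
exact: linear0.
Qed.

Lemma ab_evalM_ba N u : ab_eval N (u * (b_ * a_)) =
  if N is m.+2 then ab_step false m.+1 (ab_step true m (ab_eval m u)) else 0.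
Proof.
rewrite (mulrA u b_ a_) ab_evalM_a; case: N => [|[|m]] //; rewrite ab_evalM_b //.
exact: linear0.
Qed.

Lemma ab_evalM_d N u : ab_eval N (u * (a_ * b_ + b_ * a_)) =
  if N is m.+2 then ab_step true m.+1 (ab_step false m (ab_eval m u)) +
    ab_step false m.+1 (ab_step true m (ab_eval m u)) else 0.
Proof.
rewrite (mulrDr u (a_ * b_) (b_ * a_)); apply: etrans (ab_evalD _ _ _) _.
apply: etrans (congr2 +%R (ab_evalM_ab N u) (ab_evalM_ba N u)) _.
by case: N => [|[|m]]; rewrite ?addr0.
Qed.

(** Induction from the right: the last letter of [w] acts last on both sides, as right factor under
    [ab_eval] and as outermost operator of the reversed word. *)
Lemma ab_eval_cd_word N w : ab_eval N (cd_word_to_ab w) =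
  if cd_deg w == N then symp N (cd_value w) else 0.
Proof.
elim/last_ind: w N => [|w l IH] N.
  rewrite /cd_word_to_ab /cd_value /cd_deg !big_nil -word_nil ab_eval_word /=.
  case: eqP => // <-; apply/polyP => i.
  by rewrite coef_symp ?size_poly1 // !coef1; case: i.
rewrite cd_deg_rcons cd_value_rcons /cd_word_to_ab -cats1 big_cat big_seq1 /=.
rewrite -/(cd_word_to_ab w).
have [sz _] := cd_value_homog w.
case: l; rewrite ?addn2 ?addn1.
  rewrite ab_evalM_d; case: N => [|[|N]] //; rewrite IH !eqSS.
  case: eqP sz => [<- sz|_ _]; last by rewrite !linear0 addr0.
  exact: symp_opD.
rewrite ab_evalM_c; case: N => [|N] //; rewrite IH eqSS.
case: eqP sz => [<- sz|_ _]; last by rewrite linear0 mulr0 mul0rn addr0.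
exact: symp_opC.
Qed.

(** The part of [Phi] of cd-degree [N] contributes to [rev_op Phi 1] a polynomial that [ab_eval N]
    determines, [symp N] being injective on that parity and degree. Hence only degree [n]
    contributes. *)
Lemma symp_rev_op n Phi :
  (forall N, N != n -> ab_eval N (cd_to_ab Phi) = 0) ->
  [/\ (size (rev_op Phi 1) <= n.+1)%N, parity_poly n (rev_op Phi 1) &
     symp n (rev_op Phi 1) = ab_eval n (cd_to_ab Phi)].
Proof.
move=> homog.
pose Q N := \sum_(w <- msupp Phi | cd_deg w == N) Phi@_w *: cd_value w.
have szQ N : (size (Q N) <= N.+1)%N.
  rewrite /Q; apply: (big_ind (fun p : {poly rat} => (size p <= N.+1)%N))
    => [|p q|w /eqP<-]; first by rewrite size_poly0.
    by move=> szp szq; rewrite (leq_trans (size_polyD p q)) // geq_max szp.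
  by rewrite (leq_trans (size_scale_leq _ _)) //; case: (cd_value_homog w).
have parQ N : parity_poly N (Q N).
  move=> i odd_i; rewrite coef_sum big1 // => w /eqP degw.
  by rewrite coefZ (cd_value_homog w).2 ?mulr0 // degw.
have sympQ N : symp N (Q N) = ab_eval N (cd_to_ab Phi).
  rewrite !linear_sum /= [RHS](bigID (fun w : {fmonom bool} => cd_deg w == N)) /=.
  rewrite [X in _ + X]big1 ?addr0 => [|w degw]; last first.
    by rewrite linearZ /= ab_eval_cd_word (negPf degw) scaler0.
  by apply: eq_bigr => w degw; rewrite !linearZ /= ab_eval_cd_word degw.
have Q0 N : N != n -> Q N = 0.
  by move=> neN; apply: (symp_inj (szQ N) (parQ N)); rewrite sympQ homog.
suff -> : rev_op Phi 1 = Q n by [].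
(* [M] bounds [n] and every degree occurring in [Phi], so [inord] is faithful on these degrees. *)
pose M := (n + \max_(w <- msupp Phi) cd_deg w)%N.
have lt_deg (w : {fmonom bool}) : w \in msupp Phi -> (cd_deg w < M.+1)%N.
  move=> wPhi; rewrite ltnS (leq_trans _ (leq_addl _ _)) //.
  by rewrite (big_rem w) //= leq_maxl.
rewrite /rev_op (partition_big (fun w : {fmonom bool} => inord (cd_deg w) : 'I_M.+1)
  xpredT) //=.
have QE (N : 'I_M.+1) :
    \sum_(w <- msupp Phi | inord (cd_deg w) == N) Phi@_w *: cd_value w = Q N.
  rewrite /Q [LHS]big_seq_cond [RHS]big_seq_cond; apply: eq_bigl => w.
  case: (boolP (w \in _)) => //= wPhi.
  by rewrite -val_eqE /= inordK ?lt_deg.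
rewrite (eq_bigr (fun N : 'I_M.+1 => Q N)) => [|N _]; last exact: QE.
have ltn : (n < M.+1)%N by rewrite ltnS leq_addr.
rewrite (bigD1 (Ordinal ltn)) //= big1 ?addr0 // => N neN.
by apply: Q0; rewrite -val_eqE in neN.
Qed.

(** [ab_step] expands over supersets; after exchanging sums, each [S] collects the flag h-numbers of
    its subsets, which add up to its flag f-number. *)
Lemma ab_eval_ab_index (disp : Order.disp_t) (P : finTBPOrderType disp)
    (rho : P -> nat) n N :
  ab_eval N (ab_index rho n) = if N == n then
    \sum_(S : {set 'I_n}) (flag_f rho S)%:R *: run flag_step 0 (set_word S) 1
  else 0.
Proof.
rewrite linear_sum /=.
under eq_bigr => S _ do
  rewrite linearZ /= ab_eval_word size_map size_enum_ord eq_sym -/(set_word S).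
case: eqP => // _; last by rewrite big1 // => S _; rewrite scaler0.
under eq_bigr => S _ do rewrite run_ab_step_set scaler_sumr.
rewrite (exchange_big_dep xpredT) //=; apply: eq_bigr => S _.
by rewrite -scaler_suml -raddf_sum /= sum_flag_h.
Qed.
End CdIndex.

(** * Ranks, chains, and the toric polynomial as a sum over flags *)

Section Chains.
Context {disp : Order.disp_t} {P : finTBPOrderType disp}.
Variable rho : P -> nat.
Hypothesis rho_rank : is_rank rho.
Implicit Types (x y z p q : P) (K : {set P}).

(** Induction on the number of elements strictly between: if there is one, it splits the interval
    into two smaller ones; otherwise [y] covers [x]. *)
Lemma rank_interval x y : (x < y)%O -> (rho x < rho y)%N /\
  forall i, (rho x < i < rho y)%N -> exists2 z, (x < z < y)%O & rho z = i.
Proof.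
have [k] := ubnP #|[set z | (x < z < y)%O]|.
elim: k x y => // k IH x y; rewrite ltnS => le_k lt_xy.
have [/rho_rank.2 ->|] := boolP (covers x y); first by split=> [//|i]; lia.
rewrite /covers lt_xy negbK => /existsP[z /andP[lt_xz lt_zy]].
have smaller u v : (x <= u)%O -> (v <= y)%O -> z \notin [set t | (u < t < v)%O] ->
    (#|[set t | (u < t < v)%O]| < k)%N.
  move=> le_xu le_vy z_out; apply: leq_trans le_k; apply: proper_card.
  apply/properP; split; last by exists z; rewrite // inE lt_xz.
  apply/subsetP => t; rewrite !inE => /andP[lt_ut lt_tv].
  by rewrite (le_lt_trans le_xu) // (lt_le_trans lt_tv).
have [||rk_xz bt_xz] := IH x z; rewrite ?smaller ?inE ?ltxx ?andbF ?(ltW lt_zy) //.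
have [||rk_zy bt_zy] := IH z y; rewrite ?smaller ?inE ?ltxx ?andbF ?(ltW lt_xz) //.
split=> [|i /andP[lt_xi lt_iy]]; first exact: ltn_trans rk_zy.
case: (ltngtP i (rho z)) => [lt_iz|lt_zi|->]; last by exists z; rewrite ?lt_xz.
  have [|t /andP[xt tz] <-] := bt_xz i; first by rewrite lt_xi.
  by exists t; rewrite // xt (lt_trans tz).
have [|t /andP[zt ty] <-] := bt_zy i; first by rewrite lt_zi.
by exists t; rewrite // ty (lt_trans lt_xz).
Qed.

Lemma rank_lt x y : (x < y)%O -> (rho x < rho y)%N.
Proof. by move=> /rank_interval[]. Qed.

Lemma comparable_rank_le x y : (x >=< y)%O -> (x <= y)%O = (rho x <= rho y)%N.
Proof.
by case: comparableP => // [/rank_lt|/rank_lt|->]; lia.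
Qed.

Lemma comparable_rank_eq x y : (x >=< y)%O -> rho x = rho y -> x = y.
Proof. by case: comparableP => // /rank_lt; lia. Qed.

Definition below p : {set P} := [set x | (\bot < x < p)%O].

Definition is_top q K := (q \in K) && [forall x in K, (x <= q)%O].

Definition chain_top K : P := odflt \bot%O [pick q | is_top q K].

Lemma chain_inP (A K : {set P}) :
  reflect (K \subset A /\ {in K &, forall x y, (x >=< y)%O}) (chain_in A K).
Proof.
apply: (iffP andP) => -[sKA chK]; split=> //.
  by move=> x y xK yK; have /forall_inP/(_ x xK)/forall_inP := chK; apply.
by apply/forall_inP => x xK; apply/forall_inP => y yK; apply: chK.
Qed.

(** Rank orders the elements of a chain, so one of maximal rank is the largest; the default of
    [chain_top] is therefore not reached. *)
Lemma chain_topE A K q : chain_in A K -> K != set0 ->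
  (chain_top K == q) = is_top q K.
Proof.
case/chain_inP=> _ chK /set0Pn[x0 x0K].
have topU q1 q2 : is_top q1 K -> is_top q2 K -> q1 = q2.
  move=> /andP[q1K /forall_inP top1] /andP[q2K /forall_inP top2].
  by apply: le_anti; rewrite top1 // top2.
rewrite /chain_top; case: pickP => [q' top' /=|no_top].
  by apply/eqP/idP => [<-//|]; apply: topU.
case: (arg_maxnP (P := mem K) rho x0K) => m mK maxm.
have /idP[] := no_top m; rewrite /is_top (mK : m \in K); apply/forall_inP => x xK.
by rewrite comparable_rank_le ?chK //; apply: maxm.
Qed.

Lemma chain_in_set0 A : chain_in A (set0 : {set P}).
Proof. by apply/chain_inP; split=> [|x y]; rewrite ?sub0set ?inE. Qed.

Lemma chain_in_setU1 p q K : q \in below p ->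
  chain_in (below q) K =
  (chain_in (below p) (q |: K) && is_top q (q |: K)) && (q \notin K).
Proof.
rewrite inE => /andP[bq qp]; apply/idP/idP.
  case/chain_inP=> /subsetP sK chK.
  have ltK x : x \in K -> (\bot < x)%O /\ (x < q)%O.
    by move=> /sK; rewrite inE => /andP.
  have qK : q \notin K by apply/negP => /ltK[_]; rewrite ltxx.
  rewrite qK andbT; apply/andP; split.
    apply/chain_inP; split.
      apply/subsetP => x; rewrite !inE => /predU1P[->|/ltK[-> xq]].
        by rewrite bq.
      exact: lt_trans qp.
    move=> x y; rewrite !inE => /predU1P[->|xK] /predU1P[->|yK].
    - exact: comparablexx.
    - by rewrite comparable_sym /Order.comparable (ltW (ltK _ yK).2).
    - by rewrite /Order.comparable (ltW (ltK _ xK).2).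
    exact: chK.
  rewrite /is_top setU11; apply/forall_inP => x; rewrite !inE.
  by move=> /predU1P[->//|/ltK[_ /ltW]].
case/andP=> /andP[/chain_inP[/subsetP sK chK] /andP[_ /forall_inP topq]] qK.
apply/chain_inP; split; last first.
  by move=> x y xK yK; apply: chK; rewrite inE ?xK ?yK orbT.
apply/subsetP => x xK; have xqK : x \in q |: K by rewrite inE xK orbT.
have := sK _ xqK; rewrite !inE => /andP[-> _] /=.
by rewrite lt_neqAle topq // andbT; apply: contraNneq qK => <-.
Qed.

(* A nonempty chain is split at its largest element. *)
Lemma sum_chains (V : nmodType) (G : {set P} -> V) p :
  \sum_(K | chain_in (below p) K) G K =
  G set0 + \sum_(q in below p) \sum_(K | chain_in (below q) K) G (q |: K).
Proof.
rewrite (bigD1 set0) ?chain_in_set0 //=; congr (_ + _).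
rewrite (partition_big chain_top (fun q => q \in below p)) /=; last first.
  move=> K /andP[chK nzK]; have [/subsetP sK _] := chain_inP _ _ chK.
  by apply: sK; have := chain_topE (chain_top K) chK nzK; rewrite eqxx => /esym/andP[].
apply: eq_bigr => q qp.
rewrite (reindex_onto (fun K => q |: K) (fun K => K :\ q)) /=; last first.
  move=> K /andP[/andP[chK nzK]]; rewrite (chain_topE _ chK) // => /andP[qK _].
  exact: setD1K.
apply: eq_bigl => K; rewrite (chain_in_setU1 K qp).
have -> : ((q |: K) :\ q == K) = (q \notin K).
  apply/eqP/idP => [<-|/setU1K //]; by rewrite setD11.
congr (_ && _).
case chK: (chain_in _ _) => //=.
have nz : q |: K != set0 by apply/set0Pn; exists q; rewrite setU11.
by rewrite nz (chain_topE _ chK).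
Qed.

Definition rank_word m K : seq bool :=
  [seq [exists x in K, rho x == i.+1] | i <- iota 0 m].

Lemma size_rank_word m K : size (rank_word m K) = m.
Proof. by rewrite size_map size_iota. Qed.

Lemma rank_word_set0 m : rank_word m set0 = nseq m false.
Proof.
apply: (@eq_from_nth _ false); rewrite size_rank_word ?size_nseq // => i lt_i.
rewrite (nth_map 0%N) ?size_iota // nth_nseq if_same.
by apply/existsP => -[x]; rewrite inE.
Qed.

Lemma rank_word_setU1 p q K : q \in below p -> chain_in (below q) K ->
  rank_word (rho p).-1 (q |: K) =
  rank_word (rho q).-1 K ++ true :: nseq ((rho p).-1 - rho q) false.
Proof.
rewrite inE => /andP[bq qp] /chain_inP[/subsetP sK _].
have rq := rank_lt bq; have rp := rank_lt qp.
have rK x : x \in K -> (rho x < rho q)%N.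
  by move=> /sK; rewrite inE => /andP[_ /rank_lt].
have -> : (rho p).-1 = ((rho q).-1 + ((rho p).-1 - rho q).+1)%N by lia.
rewrite /rank_word iotaD map_cat add0n /=; congr (_ ++ _ :: _).
- apply/eq_in_map => i; rewrite mem_iota add0n => lt_i.
  apply/existsP/existsP => -[x /andP[xK ri]]; exists x; last first.
    by rewrite inE xK orbT ri.
  move: xK; rewrite !inE ri andbT => /predU1P[xq|//].
  by move: ri; rewrite xq; lia.
- by apply/existsP; exists q; rewrite setU11 prednK ?eqxx // (leq_ltn_trans _ rq).
have -> : ((rho q).-1 + ((rho p).-1 - rho q).+1 - rho q = (rho p).-1 - rho q)%N
  by lia.
apply: (@eq_from_nth _ false); rewrite size_map size_iota ?size_nseq // => i lt_i.
rewrite (nth_map 0%N) ?size_iota // nth_nseq if_same nth_iota //.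
apply/existsP => -[x /andP[]]; rewrite !inE => /predU1P[->|/rK]; lia.
Qed.

Lemma run_flag_nseq m r f :
  run flag_step m (nseq r false) f = f * ('X - 1) ^+ r.
Proof.
elim: r m f => [|r IH] m f /=; first by rewrite mulr1.
by rewrite IH exprS /flag_step mulrCA mulrA.
Qed.

Lemma toric_f_chains p : p != \bot%O ->
  toric_f rho p =
  \sum_(K | chain_in (below p) K) run flag_step 0 (rank_word (rho p).-1 K) 1.
Proof.
have [k] := ubnP (rho p); elim: k p => // k IH p; rewrite ltnS => le_pk np.
rewrite toric_fE (negPf np) sum_chains (bigD1 \bot%O) ?lt0x //=.
congr (_ + _).
  rewrite toric_gE eqxx mul1r rho_rank.1 subn0.
  by rewrite rank_word_set0 run_flag_nseq mul1r.
apply: eq_big => [q|q /andP[qp nq]]; first by rewrite inE lt0x andbC.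
have qbp : q \in below p by rewrite inE lt0x nq.
have rq0 : (0 < rho q)%N by have := @rank_lt \bot%O q; rewrite lt0x => /(_ nq); lia.
under eq_bigr => K chK do
  rewrite (rank_word_setU1 qbp chK) run_cat /= run_flag_nseq size_rank_word add0n.
rewrite -mulr_suml /flag_step toric_gE (negPf nq) prednK //.
by rewrite -linear_sum -IH // (leq_trans (rank_lt qp) le_pk).
Qed.

(** Only the minimum reaches degree [n]: for any other [q], g has degree at most half of rho(q) - 1
    and is multiplied by a polynomial of degree n - rho(q). *)
Lemma lead_toric_f n : rho \top%O = n.+1 -> (toric_f rho \top%O)`_n = 1.
Proof.
move=> rtop.
have ntop : (\top != \bot :> P)%O.
  by apply/eqP => eq_tb; move: rtop; rewrite eq_tb rho_rank.1.
rewrite toric_fE (negPf ntop) (bigD1 \bot%O) ?lt0x //= toric_gE eqxx mul1r.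
rewrite rtop rho_rank.1 subn0 coefD coef_sum big1 => [|q /andP[qt nq]].
  have := monic_exp n (monicXsubC (1 : rat)); rewrite monicE lead_coefE.
  by rewrite size_exp_XsubC addr0 polyC1 => /eqP.
have rq0 : (0 < rho q)%N by have := @rank_lt \bot%O q; rewrite lt0x => /(_ nq); lia.
have := rank_lt qt; rewrite rtop => rqn.
apply: nth_default; apply: leq_trans (size_polyMleq _ _) _.
rewrite -polyC1 size_exp_XsubC toric_gE (negPf nq).
have : (size (g_of_f (rho q) (toric_f rho q)) <= ((rho q).-1)./2.+1)%N.
  exact: size_poly.
by move: (size _) => s; lia.
Qed.

(* An unused rank [i] lies strictly between the largest element of [K] of
   smaller rank and the smallest one of larger rank, so [K] can be refined. *)
Lemma chain_refine K n i : rho \top%O = n.+1 -> (0 < i <= n)%N ->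
  {in K &, forall x y, (x >=< y)%O} -> (forall x, x \in K -> rho x != i) ->
  exists2 z, rho z = i & forall x, x \in K -> (x >=< z)%O.
Proof.
move=> rtop /andP[i_gt0 le_in] chK avoid.
(* Adjoining the minimum and the maximum ensures that [K] has neighbours on both sides of rank
   [i]. *)
pose lo x := ((x == \bot%O) || (x \in K)) && (rho x < i)%N.
pose hi x := ((x == \top%O) || (x \in K)) && (i < rho x)%N.
have lo0 : lo \bot%O by rewrite /lo eqxx rho_rank.1.
have hi1 : hi \top%O by rewrite /hi eqxx rtop ltnS.
case: (arg_maxnP rho lo0) => u /andP[uK lt_ui] maxu.
case: (arg_minnP rho hi1) => v /andP[vK lt_iv] minv.
have cmp x y : (x == \bot%O) || (x \in K) -> (y == \top%O) || (y \in K) ->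
    (x >=< y)%O.
  move=> /predU1P[->|xK] /predU1P[->|yK]; last exact: chK.
  - by rewrite /Order.comparable le0x.
  - by rewrite /Order.comparable le0x.
  by rewrite /Order.comparable lex1.
have lt_uv : (u < v)%O.
  have le_uv : (u <= v)%O by rewrite comparable_rank_le ?cmp //; lia.
  by rewrite lt_neqAle le_uv andbT; apply: contraTneq lt_ui => ->; lia.
have [|z /andP[lt_uz lt_zv] rz] := (rank_interval lt_uv).2 i; first by rewrite lt_ui.
exists z => // x xK; have := avoid x xK.
case: (ltngtP (rho x) i) => // [lt_xi|lt_ix] _; rewrite /Order.comparable.
  have le_xu : (rho x <= rho u)%N by apply: maxu; rewrite /lo xK orbT.
  suff le : (x <= u)%O by rewrite (ltW (le_lt_trans le lt_uz)).
  case/predU1P: uK le_xu => [-> le0|uK le_xu].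
    have [->//|] := eqVneq x \bot%O; rewrite -lt0x => /rank_lt.
    by move=> /leq_trans/(_ le0); rewrite ltnn.
  by rewrite comparable_rank_le ?chK.
have le_vx : (rho v <= rho x)%N by apply: minv; rewrite /hi xK orbT.
suff le : (v <= x)%O by rewrite (ltW (lt_le_trans lt_zv le)) orbT.
case/predU1P: vK le_vx => [-> le1|vK le_vx].
  have [->//|] := eqVneq x \top%O; rewrite -ltx1 => /rank_lt.
  by move=> /(leq_trans)/(_ le1); rewrite ltnn.
by rewrite comparable_rank_le ?chK.
Qed.

(** By [chain_refine], a maximal chain misses no rank of [S]; conversely, a chain has at most one
    element of each rank, so one that meets all ranks of [S] cannot grow. *)
Lemma maxset_chain_in n (S : {set 'I_n}) K : rho \top%O = n.+1 ->
  maxset (chain_in (rank_selection rho S)) K =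
  chain_in (below \top%O) K &&
    ([set i : 'I_n | [exists x in K, rho x == i.+1]] == S).
Proof.
move=> rtop; apply/maxsetP/andP => [[/chain_inP[/subsetP sK chK] maxK]|].
  split.
    apply/chain_inP; split=> //; apply/subsetP => x /sK.
    rewrite !inE => /existsP[i /andP[_ /eqP rx]]; rewrite lt0x ltx1.
    apply/andP; split; apply/eqP => ex; move: rx; rewrite ex ?rtop ?rho_rank.1 //.
    by move=> [ni]; have := ltn_ord i; rewrite -ni ltnn.
  rewrite eqEsubset; apply/andP; split; apply/subsetP => i.
    rewrite inE => /existsP[x /andP[/sK]]; rewrite inE.
    move=> /existsP[j /andP[jS /eqP->]] /eqP[ij].
    by rewrite -(ord_inj ij).
  move=> iS; rewrite inE; apply: contraT => /existsPn no_x.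
  have [||x xK|z rz cmpz] := @chain_refine K n i.+1 rtop => //.
  - exact: ltn_ord.
  - by have := no_x x; rewrite xK.
  suff zK : z \in K by have := no_x z; rewrite zK rz eqxx.
  suff <- : z |: K = K by rewrite setU11.
  apply: maxK; last exact: subsetUr.
  apply/chain_inP; split.
    apply/subsetP => x /setU1P[->|/sK //]; rewrite inE.
    by apply/existsP; exists i; rewrite iS rz eqxx.
  move=> x y /setU1P[->|xK] /setU1P[->|yK]; rewrite ?comparablexx //.
  - by rewrite comparable_sym cmpz.
  - exact: cmpz.
  exact: chK.
move=> [/chain_inP[/subsetP sK chK] /eqP rkK]; split.
  apply/chain_inP; split=> //; apply/subsetP => x xK.
  have := sK x xK; rewrite !inE => /andP[/rank_lt r0 /rank_lt r1].
  have lt_xn : ((rho x).-1 < n)%N by move: r0 r1; rewrite rtop; lia.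
  have rx : rho x = (Ordinal lt_xn).+1 by rewrite /= prednK // (leq_ltn_trans _ r0).
  apply/existsP; exists (Ordinal lt_xn); rewrite -rx eqxx andbT -rkK inE.
  by apply/existsP; exists x; rewrite xK -rx eqxx.
move=> B /chain_inP[/subsetP sB chB] sKB; apply/eqP; rewrite eqEsubset sKB andbT.
apply/subsetP => x xB; have := sB x xB.
rewrite inE => /existsP[i /andP[]]; rewrite -rkK inE.
move=> /existsP[y /andP[yK /eqP ry]] /eqP rx.
by rewrite (@comparable_rank_eq x y) ?rx ?ry // chB // (subsetP sKB).
Qed.

(** The word of a chain depends only on its set of ranks, so chains are grouped by that set. *)
Lemma toric_f_flags n : rho \top%O = n.+1 ->
  toric_f rho \top%O =
  \sum_(S : {set 'I_n}) (flag_f rho S)%:R *: run flag_step 0 (set_word S) 1.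
Proof.
move=> rtop; rewrite toric_f_chains; last first.
  by apply/eqP => eq_tb; move: rtop; rewrite eq_tb rho_rank.1.
rewrite (partition_big
  (fun K => [set i : 'I_n | [exists x in K, rho x == i.+1]]) xpredT) //=.
apply: eq_bigr => S _; rewrite scaler_nat /flag_f.
rewrite -sumr_const; apply: eq_big => K; rewrite ?inE ?maxset_chain_in //.
move=> /andP[_ /eqP<-]; rewrite rtop /=; congr run.
rewrite /rank_word -val_enum_ord -map_comp /set_word.
by apply: eq_map => i; rewrite inE.
Qed.
End Chains.

(** * Characterization of the short toric polynomial by the reversed cd-index *)

Unset Implicit Arguments.
Set Strict Implicit.

Theorem theorem4p7 (disp : Order.disp_t) (P : finTBPOrderType disp)
    (rho : P -> nat) (n : nat)
    (rho_rank : is_rank rho) (rank_P : rho \top%O = n.+1)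
    (P_eulerian : eulerian rho)
    (Phi : ncpoly) (Phi_cd : is_cd_index rho n Phi) (t : {poly rat}) :
  is_short_toric rho n t <-> t = rev_op Phi 1.
Proof.
have ab_index_eval N : ab_eval N (cd_to_ab Phi) =
    if N == n then toric_f rho \top%O else 0.
  rewrite [cd_to_ab Phi]Phi_cd ab_eval_ab_index; case: eqP => // _.
  by rewrite -toric_f_flags.
have [|sz par sym] := @symp_rev_op n Phi.
  by move=> N neN; rewrite ab_index_eval (negPf neN).
move: sym; rewrite ab_index_eval eqxx => sym.
rewrite is_short_toricE; split=> [[sz_t par_t sym_t]|->].
  (* Both polynomials symmetrize to f, and [symp n] is injective in this degree and parity. *)
  apply/eqP; rewrite -subr_eq0; apply/eqP; apply: (@symp_inj n).
  - by rewrite (leq_trans (size_polyD _ _)) // size_polyN geq_max sz_t leqnn.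
  - by move=> i odd_i; rewrite coefB par_t // par // subrr.
  by rewrite linearB /= sym sym_t subrr.
(* The degree is exactly [n]: since |n - 2n| = n, the coefficient of f at [n], which is 1, is also
   that of [rev_op Phi 1]. *)
split=> //; apply/eqP; rewrite eqn_leq sz ltnNge; apply/negP => sz_n.
have := lead_toric_f rho_rank rank_P; rewrite -sym coef_symp //.
have -> : (n - n.*2 + (n.*2 - n) = n)%N by lia.
by rewrite nth_default // => /eqP; rewrite eq_sym oner_eq0.
Qed.
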